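(* Let $g\ge 2$ and let $\mathfrak u=(u_1,\dots,u_g)$ be the $g$-tuple of dihedral invariants, $u_i=a_1^{g-i+1}a_i+a_g^{g-i+1}a_{g-i+1}\in k[a_1,\dots,a_g]$ for $1\le i\le g$. Then $k(\mathcal L_g)=k(u_1,\dots,u_g)$.
   Context: $k$ is an algebraically closed field of characteristic different from $2$. A hyperelliptic curve of genus $g$ over $k$ is a double cover of $\mathbb P^1$ ramified at $2g+2$ points; $\mathcal H_g$ is the moduli space of such curves. The hyperelliptic involution of a curve with function field $K=k(X,Y)$, $[K:k(X)]=2$, is the generator $z_0$ of $\mathrm{Gal}(K/k(X))$. An extra involution is an involution of $\mathrm{Aut}(K/k)$ different from $z_0$. $\mathcal L_g\subset\mathcal H_g$ is the locus of curves having an extra involution; every such curve has an equation $Y^2=X^{2g+2}+a_gX^{2g}+\dots+a_1X^2+1$ with $a_i\in k$ and nonzero discriminant of the right-hand side. The function field $k(\mathcal L_g)$ is viewed inside the rational function field $k(a_1,\dots,a_g)$ ($a_i$ independent indeterminates) through the map sending $(a_1,\dots,a_g)$ to the isomorphism class of this curve; it is the fixed field of the dihedral group $D_{g+1}$ of order $2g+2$ acting by $\tau_1:a_i\mapsto\varepsilon^{2i}a_i$, $\tau_2:a_i\mapsto a_{g+1-i}$ ($1\le i\le g$), where $\varepsilon\in k$ is a primitive $(2g+2)$-th root of unity. The characteristic of $k$ is assumed not to divide $2g+2$, so that $\varepsilon$ exists. *)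

(* Defs.v *)
From HB Require Import structures.
From mathcomp Require Import all_boot all_order all_algebra.
From mathcomp Require Import mpoly.

Set Implicit Arguments.
Unset Strict Implicit.
Unset Printing Implicit Defensive.

Import GRing.Theory.
Local Open Scope ring_scope.

Notation "x %:F" := (@FracField.tofrac _ x) (at level 1, format "x %:F")
  : ring_scope.

Section FractionMap.
Variables (R S : idomainType).

(* The extension of a map of domains to fraction fields.  It evaluates s on a
   chosen representative of the fraction; by frac_map_div the choice is
   irrelevant when s is an injective ring morphism. *)
Definition frac_map (s : R -> S) (x : {fraction R}) : {fraction S} :=
  (s (\n_(repr x)))%:F / (s (\d_(repr x)))%:F.

Let fracE (x : {fraction R}) : x = (\n_(repr x))%:F / (\d_(repr x))%:F.
Proof.
have d0 : (\d_(repr x))%:F != 0 by rewrite tofrac_eq0 denom_ratioP.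
apply: (mulIf d0); rewrite divfK //.
rewrite -{1}[x]reprK; case: (repr x) => -[n d] /= {}d0.
unlock FracField.tofrac; rewrite -[LHS]FracField.pi_mul.
apply/eqmodP; rewrite /= FracField.equivfE /FracField.mulf /=.
by rewrite !numden_Ratio ?mulr1 ?oner_eq0 // mulrC.
Qed.

Lemma frac_map_div (s : {rmorphism R -> S}) (p q : R) :
  injective s -> q != 0 -> frac_map s (p%:F / q%:F) = (s p)%:F / (s q)%:F.
Proof.
move=> s_inj q0; rewrite /frac_map; set x := p%:F / q%:F.
have d0 : \d_(repr x) != 0 by exact: denom_ratioP.
have s0 y : y != 0 -> (s y)%:F != 0 :> {fraction S}.
  by move=> y0; rewrite tofrac_eq0 -(rmorph0 s) (inj_eq s_inj).
have /eqP := fracE x; rewrite {1}/x eqr_div ?tofrac_eq0 //.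
rewrite -!tofracM tofrac_eq => /eqP e.
by apply/eqP; rewrite eqr_div ?s0 // -!tofracM -!rmorphM e.
Qed.

End FractionMap.

Inductive subfield_gen (F : fieldType) (S : F -> Prop) : F -> Prop :=
| sfg_mem x : S x -> subfield_gen S x
| sfg_1 : subfield_gen S 1
| sfg_sub x y : subfield_gen S x -> subfield_gen S y -> subfield_gen S (x - y)
| sfg_mul x y : subfield_gen S x -> subfield_gen S y -> subfield_gen S (x * y)
| sfg_inv x : subfield_gen S x -> subfield_gen S x^-1.

Section DihedralInvariants.
Variables (k : closedFieldType) (g : nat).

(* The indeterminates a_1, ..., a_g: the subscript starts at 1 whereas 'I_g
   starts at 0; a i is 0 outside of the range 1 <= i <= g. *)
Definition a (i : nat) : {mpoly k[g]} := \sum_(j < g | j.+1 == i) 'X_j.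

Lemma aS (j : 'I_g) : a j.+1 = 'X_j.
Proof.
by rewrite /a (big_pred1 j) // => i; rewrite eqSS.
Qed.

Definition rat_a : fieldType := {fraction {mpoly k[g]}}.

(* The substitution a_i |-> b i; a k-automorphism of k(a_1, ..., a_g) for the
   invertible linear substitutions used below. *)
Definition subst_a (b : nat -> {mpoly k[g]}) : rat_a -> rat_a :=
  frac_map (fun p : {mpoly k[g]} => p \mPo [tuple b j.+1 | j < g]).

Variable eps : k.

Definition tau1 : rat_a -> rat_a := subst_a (fun i => eps ^+ (2 * i) *: a i).
Definition tau2 : rat_a -> rat_a := subst_a (fun i => a (g + 1 - i)).

(* tau1 and tau2 have finite order when eps is a root of unity, so the monoid
   that they generate is the group D_{g+1}. *)
Inductive dihedral : (rat_a -> rat_a) -> Prop :=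
| dihedral_id : dihedral id
| dihedral_tau1 : dihedral tau1
| dihedral_tau2 : dihedral tau2
| dihedral_comp s t : dihedral s -> dihedral t -> dihedral (s \o t).

(* k(L_g) inside k(a_1, ..., a_g): the fixed field of D_{g+1} acting on the
   parameters of Y^2 = X^(2g+2) + a_g X^(2g) + ... + a_1 X^2 + 1. *)
Definition function_field_L (f : rat_a) : Prop :=
  forall s, dihedral s -> s f = f.

Definition u (i : nat) : {mpoly k[g]} :=
  a 1 ^+ (g - i + 1) * a i + a g ^+ (g - i + 1) * a (g - i + 1).

Definition field_k_u : rat_a -> Prop :=
  subfield_gen (fun x => (exists c : k, x = (c%:MP_[g])%:F) \/
                         (exists i : nat, (1 <= i <= g)%N /\ x = (u i)%:F)).

End DihedralInvariants.

(* Main.v *)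
(* The u_i are visibly invariant.  Conversely, by Cramer's rule every a_i lies in
   k(u)[a_1, a_g] up to a power of D = a_1^(g+1) - a_g^(g+1), and D^2 is in k[u].
   The trace over the dihedral group sends a_1^m a_g^l to 0 unless g + 1 divides
   m - l, in which case the result is a multiple of a power of a_1 a_g times a
   power sum of a_1^(g+1) and a_g^(g+1), whose elementary symmetric functions are
   u_1 and (u_g / 2)^(g+1); so traces land in k(u).  An invariant polynomial is,
   up to an invertible integer, its own trace, and an invariant fraction is a
   quotient of invariant polynomials: multiply by the norm of the denominator. *)

From HB Require Import structures.
Require Import Defs.
From mathcomp Require Import all_boot all_order all_algebra.
From mathcomp Require Import mpoly.
From mathcomp Require Import ring zify.

Set Implicit Arguments.
Unset Strict Implicit.
Unset Printing Implicit Defensive.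

Import GRing.Theory.
Local Open Scope ring_scope.

(** * Fractions and the maps induced on fraction fields *)

Lemma fraction_div (R : idomainType) (x : {fraction R}) :
  exists p q : R, q != 0 /\ x = p%:F / q%:F.
Proof.
exists \n_(repr x), \d_(repr x); split; first exact: denom_ratioP.
have d0 : (\d_(repr x))%:F != 0 by rewrite tofrac_eq0 denom_ratioP.
apply: (mulIf d0); rewrite divfK //.
rewrite -{1}[x]reprK; case: (repr x) => -[n d] /= {}d0.
unlock FracField.tofrac; rewrite -[LHS]FracField.pi_mul.
apply/eqmodP; rewrite /= FracField.equivfE /FracField.mulf /=.
by rewrite !numden_Ratio ?mulr1 ?oner_eq0 // mulrC.
Qed.

Section FracMapMorphism.
Context {R S : idomainType} (s : {rmorphism R -> S}).
Hypothesis s_inj : injective s.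

Let s_neq0 x : x != 0 -> s x != 0.
Proof. by rewrite -(rmorph0 s) (inj_eq s_inj). Qed.

Lemma frac_map_tofrac p : frac_map s p%:F = (s p)%:F.
Proof.
by rewrite -[p%:F]divr1 -tofrac1 frac_map_div ?oner_eq0 // rmorph1 tofrac1 divr1.
Qed.

Lemma frac_mapB x y : frac_map s (x - y) = frac_map s x - frac_map s y.
Proof.
have [p [q [q0 ->]]] := fraction_div x; have [p' [q' [q'0 ->]]] := fraction_div y.
have f0 (T : idomainType) (z : T) : z != 0 -> z%:F != 0 :> {fraction T}
  by rewrite tofrac_eq0.
rewrite -mulNr -tofracN addf_div ?f0 // -!tofracM -tofracD.
rewrite !frac_map_div ?mulf_neq0 // -mulNr -tofracN addf_div ?f0 ?s_neq0 //.
by rewrite rmorphD !rmorphM rmorphN tofracD !tofracM.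
Qed.

Lemma frac_mapM x y : frac_map s (x * y) = frac_map s x * frac_map s y.
Proof.
have [p [q [q0 ->]]] := fraction_div x; have [p' [q' [q'0 ->]]] := fraction_div y.
rewrite mulf_div -!tofracM !frac_map_div ?mulf_neq0 //.
by rewrite !rmorphM mulf_div -!tofracM.
Qed.

Lemma frac_mapV x : frac_map s x^-1 = (frac_map s x)^-1.
Proof.
have [p [q [q0 ->]]] := fraction_div x.
(* After inversion [p] is the denominator; if it vanishes, the convention [0^-1 = 0] applies. *)
have [->|p0] := eqVneq p 0.
  by rewrite tofrac0 mul0r invr0 -tofrac0 frac_map_tofrac rmorph0 tofrac0 invr0.
by rewrite invf_div !frac_map_div // invf_div.
Qed.

End FracMapMorphism.

(** * Generators of polynomial rings and of subfields *)

Section MPolyGenerators.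
Context {n : nat} {R : comNzRingType}.

Lemma mpoly_gen_ind (P : {mpoly R[n]} -> Prop) :
  (forall c, P c%:MP) -> (forall i, P 'X_i) ->
  (forall p q, P p -> P q -> P (p + q)) ->
  (forall p q, P p -> P q -> P (p * q)) -> forall p, P p.
Proof.
move=> PC PX PD PM; elim/mpolyind => [|c m p _ _ Pp].
  by rewrite -mpolyC0.
apply: (PD) => //; rewrite -mul_mpolyC; apply: (PM) => //.
rewrite mpolyXE_id; apply: (big_ind P _ PM) => [|i _]; first by rewrite -mpolyC1.
elim: (m i) => [|d IHd]; first by rewrite expr0 -mpolyC1.
by rewrite exprS; apply: PM.
Qed.

(** Relations of the dihedral group, such as [rotM] and [flip_rot], are checked on indeterminates
    through this criterion. *)
Lemma mpoly_rmorph_eq (S : nzRingType) (f h : {rmorphism {mpoly R[n]} -> S}) :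
  (forall c, f c%:MP = h c%:MP) -> (forall i, f 'X_i = h 'X_i) -> f =1 h.
Proof.
move=> fhC fhX; apply: mpoly_gen_ind => // p q fp fq.
  by rewrite !rmorphD fp fq.
by rewrite !rmorphM fp fq.
Qed.

End MPolyGenerators.

Section SubfieldGen.
Context {F : fieldType} {S : F -> Prop}.
Notation L := (subfield_gen S).

Lemma subfield_gen0 : L 0.
Proof. by rewrite -(subrr 1); apply: sfg_sub; apply: sfg_1. Qed.

Lemma subfield_genD x y : L x -> L y -> L (x + y).
Proof.
move=> Lx Ly; rewrite -[y]opprK; apply: sfg_sub => //.
by rewrite -sub0r; apply: sfg_sub => //; apply: subfield_gen0.
Qed.

Lemma subfield_genX x m : L x -> L (x ^+ m).
Proof.
move=> Lx; elim: m => [|m IHm]; first by rewrite expr0; apply: sfg_1.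
by rewrite exprS; apply: sfg_mul.
Qed.

End SubfieldGen.

(** The elements fixed by [frac_map s] form a subfield. *)
Lemma frac_map_fix_subfield_gen (R : idomainType) (s : {rmorphism R -> R})
    (S : {fraction R} -> Prop) :
  injective s -> (forall x, S x -> frac_map s x = x) ->
  forall x, subfield_gen S x -> frac_map s x = x.
Proof.
move=> s_inj sS x; elim=> {x} [x /sS//| |x y _ sx _ sy|x y _ sx _ sy|x _ sx].
- by rewrite -tofrac1 frac_map_tofrac // rmorph1.
- by rewrite frac_mapB // sx sy.
- by rewrite frac_mapM // sx sy.
- by rewrite frac_mapV // sx.
Qed.

(** * Roots of unity *)

Lemma unity_neq0 (F : fieldType) (z : F) n : (0 < n)%N -> z ^+ n = 1 -> z != 0.
Proof.
by move=> n0; apply: contra_eq_neq => ->; rewrite expr0n gtn_eqF // eq_sym oner_eq0.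
Qed.

(** Multiplication by z - 1 telescopes the sum to z^n - 1 = 0. This makes the trace kill monomials
    of nontrivial weight. *)
Lemma sum_expr_unity (F : fieldType) (z : F) n :
  z ^+ n = 1 -> \sum_(i < n) z ^+ i = if z == 1 then n%:R else 0.
Proof.
move=> zn1; have [->|z_neq1] := eqVneq z 1.
  rewrite (eq_bigr (fun=> 1)) => [|i _]; last by rewrite expr1n.
  by rewrite sumr_const card_ord.
have /eqP : (z - 1) * (\sum_(i < n) z ^+ i) = 0 by rewrite -subrX1 zn1 subrr.
by rewrite mulf_eq0 subr_eq0 (negPf z_neq1) => /eqP.
Qed.

(** * The dihedral action on polynomials *)

Section DihedralAction.
Context (k : closedFieldType) (g : nat).
Notation A := {mpoly k[g]}.
Notation a := (a k g).
Notation u := (u k g).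

(** [tau1] on polynomials, with any scalar in place of [eps], so that powers of [eps] give all
    rotations. *)
Definition rotation (c : k) : A -> A :=
  comp_mpoly [tuple c ^+ (2 * j.+1) *: a j.+1 | j < g].
Definition reflection : A -> A := comp_mpoly [tuple a (g + 1 - j.+1) | j < g].

HB.instance Definition _ c := GRing.RMorphism.on (rotation c).
HB.instance Definition _ c := GRing.Linear.on (rotation c).
HB.instance Definition _ := GRing.RMorphism.on reflection.
HB.instance Definition _ := GRing.Linear.on reflection.

Lemma rot_a c i : rotation c (a i) = c ^+ (2 * i) *: a i.
Proof.
rewrite {1}/Defs.a rmorph_sum scaler_sumr; apply: eq_bigr => j /eqP <-.
by rewrite /= /rotation comp_mpolyXU -tnth_nth tnth_mktuple aS.
Qed.

Lemma flip_a i : (0 < i <= g)%N -> reflection (a i) = a (g + 1 - i).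
Proof.
case: i => // i ltig; rewrite (aS k (Ordinal ltig)).
by rewrite /reflection comp_mpolyXU -tnth_nth tnth_mktuple.
Qed.

Lemma rotC c d : rotation c d%:MP = d%:MP.
Proof. exact: comp_mpolyC. Qed.

Lemma flipC d : reflection d%:MP = d%:MP.
Proof. exact: comp_mpolyC. Qed.

Lemma rotM c d p : rotation c (rotation d p) = rotation (c * d) p.
Proof.
apply: (mpoly_rmorph_eq (f := rotation c \o rotation d)
                        (h := rotation (c * d))) => [e|i] /=.
  by rewrite !rotC.
by rewrite -aS !rot_a linearZ /= rot_a scalerA exprMn mulrC.
Qed.

Lemma rot1 p : rotation 1 p = p.
Proof.
apply: (mpoly_rmorph_eq (f := rotation 1) (h := idfun)) => [e|i] /=; first exact: rotC.
by rewrite -aS rot_a expr1n scale1r.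
Qed.

Lemma flipK : involutive reflection.
Proof.
apply: (mpoly_rmorph_eq (f := reflection \o reflection) (h := idfun)) => [e|i] /=.
  by rewrite !flipC.
have ltig := ltn_ord i.
rewrite -aS !flip_a //; last by lia.
by congr (a _); lia.
Qed.

Lemma rot_inj c : c != 0 -> injective (rotation c).
Proof.
move=> c0; apply: (can_inj (g := rotation c^-1)) => p.
by rewrite rotM mulVf // rot1.
Qed.

(** On a_i the scalars c^(2i) and c^(-2(g+1-i)) agree, their quotient being c^(2g+2) = 1. *)
Lemma flip_rot c p : c ^+ (2 * g + 2) = 1 ->
  reflection (rotation c p) = rotation c^-1 (reflection p).
Proof.
move=> cn1.
apply: (mpoly_rmorph_eq (f := reflection \o rotation c)
                        (h := rotation c^-1 \o reflection)).
  by move=> e /=; rewrite flipC !rotC flipC.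
move=> i /=; have ltig := ltn_ord i.
rewrite -aS rot_a linearZ /= flip_a // rot_a; congr (_ *: _).
have c0 : c != 0 by apply: (unity_neq0 _ cn1); rewrite addn2.
apply: (mulIf (expf_neq0 (2 * (g + 1 - i.+1)) c0)).
rewrite -exprD exprVn mulVf ?expf_neq0 //.
by rewrite -cn1; congr (_ ^+ _); lia.
Qed.

Lemma rot_u c i : c ^+ (2 * g + 2) = 1 -> (0 < i <= g)%N -> rotation c (u i) = u i.
Proof.
move=> cn1 /andP[i0 leig]; rewrite /Defs.u rmorphD !rmorphM !rmorphXn /= !rot_a.
rewrite !exprZn -!scalerAl -!scalerAr !scalerA -!exprM -!exprD.
have -> : (2 * 1 * (g - i + 1) + 2 * i = 2 * g + 2)%N by lia.
have -> : (2 * g * (g - i + 1) + 2 * (g - i + 1) = (2 * g + 2) * (g - i + 1))%N.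
  by lia.
by rewrite exprM cn1 expr1n !scale1r.
Qed.

Lemma flip_u i : (0 < i <= g)%N -> reflection (u i) = u i.
Proof.
move=> /andP[i0 leig]; rewrite /Defs.u rmorphD !rmorphM !rmorphXn /=.
rewrite !flip_a; try lia.
have -> : (g + 1 - 1 = g)%N by lia.
have -> : (g + 1 - g = 1)%N by lia.
have -> : (g + 1 - i = g - i + 1)%N by lia.
have -> : (g + 1 - (g - i + 1) = i)%N by lia.
by rewrite addrC.
Qed.

End DihedralAction.

(** * Polynomials lying in k(u) *)

Section PolynomialsInvariants.
Context (k : closedFieldType) (g : nat) (eps : k).
Hypothesis g_ge2 : (2 <= g)%N.
Hypothesis eps_prim : (2 * g + 2).-primitive_root eps.
Hypothesis two_neq0 : 2%:R != 0 :> k.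
Hypothesis order_neq0 : (2 * g + 2)%:R != 0 :> k.

Notation A := {mpoly k[g]}.
Notation a := (a k g).
Notation u := (u k g).
Notation x := (a 1).
Notation y := (a g).
Notation rotation := (@rotation k g).
Notation reflection := (@reflection k g).
Notation k_u := (@field_k_u k g).
Notation in_k_u p := (k_u (p : A)%:F).
Implicit Types p q : A.

Let eps_order : eps ^+ (2 * g + 2) = 1. Proof. exact: prim_expr_order. Qed.

Let eps_neq0 : eps != 0.
Proof. by apply: (unity_neq0 _ eps_order); rewrite addn2. Qed.

Lemma in_k_uD p q : in_k_u p -> in_k_u q -> in_k_u (p + q).
Proof. by rewrite tofracD; apply: subfield_genD. Qed.

Lemma in_k_uB p q : in_k_u p -> in_k_u q -> in_k_u (p - q).
Proof. by rewrite tofracB; apply: sfg_sub. Qed.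

Lemma in_k_uM p q : in_k_u p -> in_k_u q -> in_k_u (p * q).
Proof. by rewrite tofracM; apply: sfg_mul. Qed.

Lemma in_k_uX p m : in_k_u p -> in_k_u (p ^+ m).
Proof. by rewrite tofracXn; apply: subfield_genX. Qed.

Lemma in_k_uC c : in_k_u c%:MP.
Proof. by apply: sfg_mem; left; exists c. Qed.

Lemma in_k_uZ c p : in_k_u p -> in_k_u (c *: p).
Proof. by rewrite -mul_mpolyC; apply: in_k_uM; apply: in_k_uC. Qed.

Lemma in_k_u_u i : (0 < i <= g)%N -> in_k_u (u i).
Proof. by move=> hi; apply: sfg_mem; right; exists i. Qed.

Lemma rot_field_k_u c f :
  c ^+ (2 * g + 2) = 1 -> c != 0 -> k_u f -> frac_map (rotation c) f = f.
Proof.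
move=> cn1 c0; apply: frac_map_fix_subfield_gen; first exact: rot_inj.
move=> _ [[d ->]|[i [hi ->]]]; rewrite frac_map_tofrac; try exact: rot_inj.
  by rewrite /= rotC.
by rewrite /= rot_u.
Qed.

Lemma flip_field_k_u f : k_u f -> frac_map (reflection) f = f.
Proof.
have flip_inj := can_inj (@flipK k g).
apply: frac_map_fix_subfield_gen => // _ [[d ->]|[i [hi ->]]].
  by rewrite frac_map_tofrac //= flipC.
by rewrite frac_map_tofrac //= flip_u.
Qed.

(** Invariance descends from fractions to polynomials, so coefficients in k(u) can be pulled out of
    traces. *)
Lemma rot_in_k_u c p : c ^+ (2 * g + 2) = 1 -> c != 0 -> in_k_u p -> rotation c p = p.
Proof.
move=> cn1 c0 /(rot_field_k_u cn1 c0); rewrite frac_map_tofrac; last exact: rot_inj.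
by move/eqP; rewrite tofrac_eq => /eqP.
Qed.

Lemma flip_in_k_u p : in_k_u p -> reflection p = p.
Proof.
move=> /flip_field_k_u; rewrite frac_map_tofrac; last exact: can_inj (@flipK k g).
by move/eqP; rewrite tofrac_eq => /eqP.
Qed.

Lemma in_k_u_xy : in_k_u (x * y).
Proof.
(* Characteristic different from 2 enters here: u_g is twice a_1 a_g. *)
have ug : u g = 2%:R *: (x * y).
  by rewrite /Defs.u subnn add0n !expr1 [y * x]mulrC scaler_nat mulr2n.
rewrite -[x * y](scalerK two_neq0) -ug; apply: in_k_uZ.
by apply: in_k_u_u; lia.
Qed.

Lemma in_k_u_power_sum j : in_k_u (x ^+ ((g + 1) * j) + y ^+ ((g + 1) * j)).
Proof.
rewrite !exprM; set v := x ^+ _; set w := y ^+ _.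
have Ls : in_k_u (v + w).
  have -> : v + w = u 1; last by apply: in_k_u_u; lia.
  rewrite /Defs.u -!exprSr /v /w; have -> : (g - 1 + 1 = g)%N by lia.
  by rewrite -exprSr addn1.
have Lp : in_k_u (v * w) by rewrite -exprMn; apply: in_k_uX; apply: in_k_u_xy.
(* The recurrence for power sums of v and w has order two, hence an induction on two consecutive
   ones. *)
suff: in_k_u (v ^+ j + w ^+ j) /\ in_k_u (v ^+ j.+1 + w ^+ j.+1) by case.
elim: j => [|j [IH0 IH1]]; split => //; rewrite ?expr0 ?expr1 //.
  by rewrite -mpolyC1 -mpolyCD; apply: in_k_uC.
have -> : v ^+ j.+2 + w ^+ j.+2
    = (v + w) * (v ^+ j.+1 + w ^+ j.+1) - (v * w) * (v ^+ j + w ^+ j).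
  by rewrite !exprS; ring.
by apply: in_k_uB; apply: in_k_uM.
Qed.

(** Since g is -1 modulo g + 1, the hypothesis says that m and l are congruent; the factor (a_1
    a_g)^min(m,l) leaves a power sum. *)
Lemma in_k_u_sym_monomial m l :
  (g + 1 %| m + g * l)%N -> in_k_u (x ^+ m * y ^+ l + y ^+ m * x ^+ l).
Proof.
wlog le_lm : m l / (l <= m)%N => [wlg|] dvd_ml.
  have [/wlg|/ltnW le_ml] := leqP l m; first exact.
  rewrite addrC [y ^+ m * _]mulrC [x ^+ m * _]mulrC; apply: wlg => //.
  (* The two weights add up to (m + l)(g + 1), so the hypothesis is symmetric in m and l. *)
  have : (g + 1 %| (m + g * l) + (l + g * m))%N.
    by apply/dvdnP; exists (m + l)%N; lia.
  by rewrite dvdn_addr.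
have /dvdnP[j Ej] : (g + 1 %| m - l)%N.
  have E : (m + g * l = (m - l) + l * (g + 1))%N by lia.
  by move: dvd_ml; rewrite E dvdn_addl // dvdn_mull.
have -> : x ^+ m * y ^+ l + y ^+ m * x ^+ l
    = (x * y) ^+ l * (x ^+ ((g + 1) * j) + y ^+ ((g + 1) * j)).
  rewrite -[m](subnK le_lm) Ej mulnC !exprD exprMn; ring.
apply: in_k_uM; last exact: in_k_u_power_sum.
by apply: in_k_uX; apply: in_k_u_xy.
Qed.

(** * Traces over the dihedral group *)

(* The sum runs twice over the rotations, [rotation] only depending on the square
   of its argument. *)
Definition rot_trace p := \sum_(i < 2 * g + 2) rotation (eps ^+ i) p.
Definition dihedral_trace p := rot_trace p + reflection (rot_trace p).

Let eps_exp_order i : (eps ^+ i) ^+ (2 * g + 2) = 1.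
Proof. by rewrite exprAC eps_order expr1n. Qed.

Lemma dihedral_traceD p q :
  dihedral_trace (p + q) = dihedral_trace p + dihedral_trace q.
Proof.
have rD : rot_trace (p + q) = rot_trace p + rot_trace q.
  by rewrite -big_split; apply: eq_bigr => i _; rewrite rmorphD.
by rewrite /dihedral_trace rD rmorphD addrACA.
Qed.

Lemma dihedral_trace_monomial c m l :
  in_k_u c -> in_k_u (dihedral_trace (c * x ^+ m * y ^+ l)).
Proof.
(* [z] is the scalar by which the rotation by [eps] acts on a_1^m a_g^l. *)
move=> Lc; pose z := eps ^+ (2 * (m + g * l)).
have rotE : rot_trace (c * x ^+ m * y ^+ l)
    = (if z == 1 then (2 * g + 2)%:R else 0) *: (c * (x ^+ m * y ^+ l)).
  rewrite -(sum_expr_unity (eps_exp_order _)) scaler_suml; apply: eq_bigr => i _.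
  rewrite !rmorphM !rmorphXn /= !rot_a rot_in_k_u ?expf_neq0 //.
  rewrite !exprZn -!scalerAr -!scalerAl scalerA mulrA; congr (_ *: _).
  by rewrite -!exprM -exprD; congr (_ ^+ _); lia.
rewrite /dihedral_trace rotE; case: eqVneq => [z1|_]; last first.
  by rewrite !scale0r rmorph0 addr0 -mpolyC0; apply: in_k_uC.
rewrite linearZ -scalerDr /= rmorphM !rmorphM !rmorphXn /=.
rewrite flip_in_k_u // !flip_a; try lia.
rewrite addnK addKn -mulrDr; apply: in_k_uZ; apply: in_k_uM => //.
apply: in_k_u_sym_monomial.
(* As [eps] is primitive, z = 1 means that 2g + 2 divides 2(m + g l). *)
rewrite -(@dvdn_pmul2l 2) // mulnDr muln1 (prim_order_dvd eps_prim).
exact/eqP.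
Qed.

(** * Clearing denominators and invariant polynomials *)

(** The ring generated by a_1 and a_g over the polynomials in k(u); coefficients stay polynomial
    because the trace is defined on polynomials only. *)
Inductive k_u_span : A -> Prop :=
| k_u_span_monomial c m l : in_k_u c -> k_u_span (c * x ^+ m * y ^+ l)
| k_u_span_add p q : k_u_span p -> k_u_span q -> k_u_span (p + q).

Lemma k_u_span_trace p : k_u_span p -> in_k_u (dihedral_trace p).
Proof.
elim=> {p} [c m l|p q _ Lp _ Lq]; first exact: dihedral_trace_monomial.
by rewrite dihedral_traceD; apply: in_k_uD.
Qed.

Lemma k_u_span_in_k_u c : in_k_u c -> k_u_span c.
Proof. by move/(k_u_span_monomial 0 0); rewrite !expr0 !mulr1. Qed.

Lemma k_u_span_mul p q : k_u_span p -> k_u_span q -> k_u_span (p * q).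
Proof.
move=> Sp Sq; elim: Sp => {p} [c m l Lc|p p' _ Sp _ Sp']; last first.
  by rewrite mulrDl; apply: k_u_span_add.
elim: Sq => {q} [d m' l' Ld|q q' _ Sq _ Sq']; last first.
  by rewrite mulrDr; apply: k_u_span_add.
have -> : c * x ^+ m * y ^+ l * (d * x ^+ m' * y ^+ l')
    = (c * d) * x ^+ (m + m') * y ^+ (l + l').
  by rewrite !exprD; ring.
by apply: k_u_span_monomial; apply: in_k_uM.
Qed.

Lemma k_u_span_exp p m : k_u_span p -> k_u_span (p ^+ m).
Proof.
move=> Sp; elim: m => [|m IHm]; last by rewrite exprS; apply: k_u_span_mul.
by rewrite expr0 -mpolyC1; apply: k_u_span_in_k_u; apply: in_k_uC.
Qed.

Notation D := (x ^+ (g + 1) - y ^+ (g + 1)).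

Lemma k_u_span_D : k_u_span D.
Proof.
have C c : in_k_u c%:MP by apply: in_k_uC.
have := k_u_span_add (k_u_span_monomial (g + 1) 0 (C 1))
                     (k_u_span_monomial 0 (g + 1) (C (-1))).
by rewrite !expr0 mpolyCN mpolyC1 !mulr1 mul1r mulN1r.
Qed.

Lemma D_neq0 : D != 0.
Proof.
have lt0g : (0 < g)%N by lia.
have ltg1 : (g.-1 < g)%N by lia.
(* Evaluation at a_1 = 1 and all other a_i = 0; a_g is not a_1 because g >= 2. *)
apply/eqP => /(congr1 (meval (fun i : 'I_g => (val i == 0%N)%:R))).
rewrite (aS k (Ordinal lt0g)).
have -> : y = 'X_(Ordinal ltg1) by rewrite -aS /= prednK.
rewrite mevalB !rmorphXn /= !mevalXU meval0 /= expr1n.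
have -> : (g.-1 == 0)%N = false by lia.
by rewrite addn1 expr0n subr0 => /eqP; rewrite oner_eq0.
Qed.

(** Reflection negates [D], but D^2 is the discriminant (v + w)^2 - 4vw for v = a_1^(g+1) and w =
    a_g^(g+1). *)
Lemma in_k_u_D2 : in_k_u (D ^+ 2).
Proof.
have -> : D ^+ 2 = (x ^+ ((g + 1) * 1) + y ^+ ((g + 1) * 1)) ^+ 2
                   - 4%:R%:MP * (x * y) ^+ (g + 1).
  by rewrite muln1 exprMn mpolyC_nat; ring.
apply: in_k_uB; first by apply: in_k_uX; apply: in_k_u_power_sum.
apply: in_k_uM; first exact: in_k_uC.
by apply: in_k_uX; apply: in_k_u_xy.
Qed.

(* [u i] and [u (g + 1 - i)] are linear in [a i] and [a (g + 1 - i)], with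
   determinant [D]; this is Cramer's rule. *)
Lemma a_mul_D i : (0 < i <= g)%N ->
  D * a i = x ^+ i * u i - y ^+ (g + 1 - i) * u (g + 1 - i).
Proof.
move=> /andP[i0 leig]; rewrite /Defs.u.
have -> : (g - (g + 1 - i) + 1 = i)%N by lia.
have -> : (g - i + 1 = g + 1 - i)%N by lia.
have -> : (g + 1 = i + (g + 1 - i))%N by lia.
rewrite addKn; set j := (g + 1 - i)%N.
by rewrite !exprD; ring.
Qed.

(** Each indeterminate costs one factor [D] by [a_mul_D]; exponents add up under sums and
    products. *)
Lemma k_u_span_clear p : exists m, k_u_span (D ^+ m * p).
Proof.
move: p; apply: mpoly_gen_ind => [c|i|p q [m Sp] [l Sq]|p q [m Sp] [l Sq]].
- exists 0%N; rewrite expr0 mul1r.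
  by apply: k_u_span_in_k_u; apply: in_k_uC.
- exists 1%N; rewrite expr1 -aS a_mul_D; last by have := ltn_ord i; lia.
  have := ltn_ord i; set j := i.+1 => ltig.
  have Lu : in_k_u (u j) by apply: in_k_u_u; lia.
  have Lu' : in_k_u (- u (g + 1 - j)).
    by rewrite -scaleN1r; apply: in_k_uZ; apply: in_k_u_u; lia.
  have := k_u_span_add (k_u_span_monomial j 0 Lu)
                       (k_u_span_monomial 0 (g + 1 - j) Lu').
  by rewrite !expr0 !mulr1 mulNr [u j * _]mulrC [u _ * _]mulrC.
- exists (m + l)%N; rewrite mulrDr exprD -mulrA [_ ^+ m * _]mulrCA -mulrA.
  have SD := k_u_span_exp _ k_u_span_D.
  by apply: k_u_span_add; apply: k_u_span_mul.
- by exists (m + l)%N; rewrite exprD mulrACA; apply: k_u_span_mul.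
Qed.

Lemma invariant_polynomial_in_k_u p :
  rotation eps p = p -> reflection p = p -> in_k_u p.
Proof.
move=> rp fp; have [m Sp] := k_u_span_clear p.
(* The exponent is doubled because the factor multiplying [p] has to be invariant. *)
have {}Sp : k_u_span ((D ^+ 2) ^+ m * p).
  rewrite -exprM mul2n -addnn exprD -mulrA; apply: k_u_span_mul => //.
  by apply: k_u_span_exp; apply: k_u_span_D.
have LW := in_k_uX m in_k_u_D2; have {Sp} := k_u_span_trace Sp.
have W0 : (D ^+ 2) ^+ m != 0 by rewrite !expf_neq0 // D_neq0.
set W := (D ^+ 2) ^+ m in LW W0 *.
have rotiE i : rotation (eps ^+ i) (W * p) = W * p.
  rewrite rmorphM /= rot_in_k_u ?expf_neq0 //; congr (_ * _).
  elim: i => [|i IHi]; first by rewrite expr0 rot1.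
  by rewrite exprS -rotM IHi.
have traceE : rot_trace (W * p) = (2 * g + 2)%:R *: (W * p).
  rewrite scaler_nat -[in RHS](card_ord (2 * g + 2)) -sumr_const.
  by apply: eq_bigr => i _.
rewrite /dihedral_trace traceE linearZ /= rmorphM /= fp flip_in_k_u //.
rewrite -mulr2n -scaler_nat scalerA.
(* The 2g + 2 rotations and the reflection make the trace of the invariant W p equal to 2(2g + 2) W
   p. *)
move/(in_k_uZ (2%:R * (2 * g + 2)%:R)^-1).
rewrite scalerK ?mulf_neq0 // => LWp.
rewrite -[p%:F](mulKf (x := W%:F)) ?tofrac_eq0 // -tofracM.
by apply: sfg_mul => //; apply: sfg_inv.
Qed.

(** * Norms and invariant fractions *)

(** The square of the norm over the dihedral group, each rotation occurring twice; [reflection q]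
    supplies the images under the other coset. *)
Definition dihedral_norm q :=
  \prod_(i < 2 * g + 2) rotation (eps ^+ i) (q * reflection q).

Lemma prod_orbit_shift (F : k -> A) :
  \prod_(i < 2 * g + 2) F (eps ^+ i.+1) = \prod_(i < 2 * g + 2) F (eps ^+ i).
Proof.
have := eps_order; rewrite addn2 => eo.
(* The last factor on the left and the first on the right are both taken at eps^(2g+2) = 1 =
   eps^0. *)
by rewrite big_ord_recr [RHS]big_ord_recl /= eo expr0 mulrC.
Qed.

Lemma rot_dihedral_norm q : rotation eps (dihedral_norm q) = dihedral_norm q.
Proof.
rewrite /dihedral_norm -[RHS](prod_orbit_shift (fun c => rotation c (q * reflection q))).
by rewrite rmorph_prod; apply: eq_bigr => i _ /=; rewrite rotM -exprS.
Qed.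

Lemma flip_dihedral_norm q : reflection (dihedral_norm q) = dihedral_norm q.
Proof.
rewrite /dihedral_norm -[RHS](prod_orbit_shift (fun c => rotation c (q * reflection q))).
(* Reflection inverts the powers of [eps]; with the indices reversed, the inverse is eps^(i+1), as
   in the shifted product. *)
rewrite rmorph_prod (reindex_inj rev_ord_inj); apply: eq_bigr => i _ /=.
rewrite flip_rot // rmorphM /= flipK [reflection q * q]mulrC; congr (rotation _ _).
apply: (mulfI (expf_neq0 (2 * g + 2 - i.+1) eps_neq0)).
by rewrite mulfV ?expf_neq0 // -exprD subnK // eps_order.
Qed.

Lemma dihedral_norm_neq0 q : q != 0 -> dihedral_norm q != 0.
Proof.
move=> q0; apply/prodf_neq0 => i _.
have rot0 := rot_inj (expf_neq0 i eps_neq0).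
rewrite -(rmorph0 (rotation (eps ^+ i))) (inj_eq (rot0 _)) mulf_neq0 //.
by rewrite -(rmorph0 reflection) (inj_eq (can_inj (@flipK k g))).
Qed.

Lemma dvd_dihedral_norm q : exists c, dihedral_norm q = q * c.
Proof.
rewrite /dihedral_norm addn2 big_ord_recl expr0 rot1 -mulrA.
by eexists.
Qed.

Lemma function_field_LP f : function_field_L eps f <-> k_u f.
Proof.
have tau1E : tau1 eps =1 frac_map (rotation eps) by [].
have tau2E : @tau2 k g =1 frac_map reflection by [].
have flip_inj := can_inj (@flipK k g).
split=> [Lf|Lf s]; last first.
  elim=> {s} [|||s t _ sf _ tf] //=.
  - by rewrite tau1E rot_field_k_u.
  - by rewrite tau2E flip_field_k_u.
  - by rewrite tf sf.
have [p [q [q0 Ef]]] := fraction_div f.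
have [c Ec] := dvd_dihedral_norm q; have N0 := dihedral_norm_neq0 q0.
have c0 : c != 0 by apply: contraNneq N0; rewrite Ec => ->; rewrite mulr0.
(* With an invariant denominator, invariance of [f] forces that of the numerator. *)
have {}Ef : f = (p * c)%:F / (dihedral_norm q)%:F.
  by rewrite Ec !tofracM -mulf_div divff ?mulr1 // tofrac_eq0.
have NF0 : (dihedral_norm q)%:F != 0 :> {fraction A} by rewrite tofrac_eq0.
have := Lf _ (dihedral_tau1 _ _); rewrite tau1E Ef frac_map_div //; last exact: rot_inj.
have := Lf _ (dihedral_tau2 _ _); rewrite tau2E Ef frac_map_div //=.
rewrite rot_dihedral_norm flip_dihedral_norm.
move/(divIf NF0)/eqP; rewrite tofrac_eq => /eqP fp.
move/(divIf NF0)/eqP; rewrite tofrac_eq => /eqP rp.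
apply: sfg_mul; first exact: invariant_polynomial_in_k_u.
apply: sfg_inv; apply: invariant_polynomial_in_k_u.
  exact: rot_dihedral_norm.
exact: flip_dihedral_norm.
Qed.

End PolynomialsInvariants.

Theorem theorem1 (k : closedFieldType) (g : nat) (eps : k)
  (char_not_2 : 2%N \notin [pchar k])
  (char_ndvd : forall p : nat, p \in [pchar k] -> ~~ (p %| 2 * g + 2)%N)
  (g_ge2 : (2 <= g)%N)
  (eps_prim : (2 * g + 2).-primitive_root eps) :
  forall f : rat_a k g, function_field_L eps f <-> field_k_u f.
Proof.
have two_neq0 : 2%:R != 0 :> k by move: char_not_2; rewrite inE.
apply: function_field_LP => //.
(* No prime divisor of 2g + 2 is the characteristic, so 2g + 2 is nonzero in k. *)
rewrite natf_neq0_pchar; apply/pnatP => [|p p_prime p_dvd].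
  by rewrite addn2.
by apply/negP => /char_ndvd; rewrite p_dvd.
Qed.
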